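(* Let $p>2$ be prime, $t\ge 1$, and $a$ an integer not divisible by $p$. Put $$A(p,t)=\frac{(p-3)p^{t-1}}{2}+\frac{p^{t-1}}{p+1}+\frac{3}{2}+\frac{(-1)^{t-1}(p-1)}{2(p+1)}.$$ Then $\#\bar{S}_2(a;p^t)=A(p,t)$ if $\left(\frac{a}{p}\right)=1$ and $\#\bar{S}_2(a;p^t)=\frac{\phi(p^t)}{2}$ if $\left(\frac{a}{p}\right)=-1$. Further, $\#\bar{D}_2(a;p^t)=A(p,t)$ if either $p\equiv 1\bmod 4$ and $\left(\frac{a}{p}\right)=1$, or $p\equiv 3\bmod 4$ and $\left(\frac{a}{p}\right)=-1$; and $\#\bar{D}_2(a;p^t)=\frac{\phi(p^t)}{2}$ if either $p\equiv 1\bmod 4$ and $\left(\frac{a}{p}\right)=-1$, or $p\equiv 3\bmod 4$ and $\left(\frac{a}{p}\right)=1$.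
   Context: For $n\ge2$ and $a$ coprime to $n$, $H_2(a;n)=\{(x,y)\in\mathbb{Z}^2: xy\equiv a \bmod n,\ 1\le x,y<n\}$, $\bar{S}_2(a;n)=\{x+y \bmod n:(x,y)\in H_2(a;n)\}$ and $\bar{D}_2(a;n)=\{x-y \bmod n:(x,y)\in H_2(a;n)\}$. $\phi$ is Euler's totient function and $\left(\frac{a}{p}\right)$ is the Legendre symbol. *)

(* Defs.v *)
From mathcomp Require Import all_boot all_order all_algebra.

Set Implicit Arguments.
Unset Strict Implicit.
Unset Printing Implicit Defensive.

Import GRing.Theory Num.Theory.
Local Open Scope ring_scope.

(* 'I_n ranges over 0 <= x < n, hence only the lower bound 1 <= x is added. *)
Definition H2 (a : int) (n : nat) : {set 'I_n * 'I_n} :=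
  [set u : 'I_n * 'I_n | [&& (1 <= u.1)%N, (1 <= u.2)%N
     & ((u.1 * u.2)%N%:Z == a %[mod n%:Z])%Z]].

(* 'Z_n is the ring of residues mod n only for n >= 2. *)
Definition S2bar (a : int) (n : nat) : {set 'Z_n} :=
  [set (u.1 : nat)%:R + (u.2 : nat)%:R | u : 'I_n * 'I_n in H2 a n].

Definition D2bar (a : int) (n : nat) : {set 'Z_n} :=
  [set (u.1 : nat)%:R - (u.2 : nat)%:R | u : 'I_n * 'I_n in H2 a n].

Definition legendre (a : int) (p : nat) : int :=
  if (p%:Z %| a)%Z then 0
  else if [exists x : 'I_p, ((x ^ 2)%N%:Z == a %[mod p%:Z])%Z] then 1
  else -1.

(* Used only with t >= 1, so that t.-1 is t - 1. *)
Definition A_count (p t : nat) : rat :=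
  (p%:R - 3%:R) * p%:R ^+ t.-1 / 2%:R + p%:R ^+ t.-1 / (p%:R + 1)
  + 3%:R / 2%:R + (-1) ^+ t.-1 * (p%:R - 1) / (2%:R * (p%:R + 1)).

(* Main.v *)
Require Import Defs.
From mathcomp Require Import all_boot all_order all_algebra.
From mathcomp Require Import ring lra zify.

Set Implicit Arguments.
Unset Strict Implicit.
Unset Printing Implicit Defensive.

Import GRing.Theory Num.Theory.
Local Open Scope ring_scope.

(* Let [R] be a finite local ring with maximal ideal [M] in which 2 is
invertible, such as Z/p^t. The sets of sums and of differences of the modular
hyperbola [x * y = a] are [S a] and [S (- a)], where [S a] is the set of all
[x + y] with [x * y = a], that is, the set of all [s] whose discriminant
[s ^+ 2 - 4 * a] is a square.

If the discriminant is a unit, [s] comes from exactly two points, exchanged by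
swapping coordinates. If it lies in [M], then [s ^+ 2] is in [4 * a + M]; when
[a] is not a square this class contains no square, and when [a] is a square it
consists of squares of units (Hensel), each having exactly two square roots, so
that there are twice as many such [s] as squares in [M]. Finally the squares in
the maximal ideal of Z/p^(t+2) correspond to all the squares of Z/p^t, which
gives a two-step recursion for their number. *)

Lemma card_two_to_one (T U : finType) (f : T -> U) (s : T -> T) (A : {set T}) :
    {in A, forall x, s x \in A} -> {in A, forall x, s x != x} ->
    {in A &, forall x y, (f x == f y) = (y == x) || (y == s x)} ->
  #|A| = (#|f @: A| * 2)%N.
Proof.
move=> sA sN fE; rewrite -sum1_card (partition_big_imset f) -sum_nat_const /=.
apply: eq_bigr => _ /imsetP[x xA ->].
have <- : #|[set x; s x]| = 2%N by rewrite cards2 eq_sym sN.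
rewrite sum1_card; apply: eq_card => y; rewrite !inE unfold_in /=.
have [yA|yNA] /= := boolP (y \in A); first by rewrite eq_sym fE.
by apply/esym/norP; split; apply: contraNneq yNA => ->; rewrite ?sA.
Qed.

Lemma odd_card_involution (T : finType) (s : T -> T) (A : {set T}) :
    {in A, forall x, s x \in A} -> {in A, involutive s} ->
  odd #|A| = odd #|[set x in A | s x == x]|.
Proof.
move=> sA sK; rewrite -(cardsID [set x | s x == x] A) oddD setIdE.
rewrite (@card_two_to_one _ _ (fun x => [set x; s x]) s (_ :\: _)).
- by rewrite oddM andbF addbF.
- move=> x; rewrite !inE => /andP[sxN xA].
  by rewrite sK // eq_sym sxN sA.
- by move=> x; rewrite !inE => /andP[].
move=> x y; rewrite !inE => /andP[_ xA] _.
apply/eqP/orP => [xyE|[] /eqP -> //]; last by rewrite sK // setUC.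
by apply/orP; rewrite -in_set2 xyE set21.
Qed.

Section FiniteRing.

Variable R : finComUnitRingType.
Implicit Types a x y : R.

Definition units : {set R} := [set x | x \is a GRing.unit].

Definition squares : {set R} := [set x ^+ 2 | x : R].

Definition unit_squares : {set R} := squares :&: units.

Definition nonunit_squares : {set R} := squares :\: units.

(* When [R] is local, this is the class of [a] modulo its maximal ideal. *)
Definition residue_class a : {set R} := [set a + z | z in ~: units].

Definition hyperbola a : {set R * R} := [set u | u.1 * u.2 == a].

Definition hyperbola_sums a : {set R} := [set u.1 + u.2 | u in hyperbola a].

Definition regular_hyperbola a : {set R * R} :=
  [set u in hyperbola a | u.1 - u.2 \is a GRing.unit].

(* If [s = x + y] and [x * y = a] then [s ^+ 2 - 4 * a = (x - y) ^+ 2], so these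
   are the sums of the points of the regular hyperbola. *)
Definition regular_sums a : {set R} :=
  [set s in hyperbola_sums a | s ^+ 2 - 4 * a \is a GRing.unit].

Definition singular_sums a : {set R} :=
  [set s in hyperbola_sums a | s ^+ 2 - 4 * a \isn't a GRing.unit].

Lemma squaresP a : reflect (exists x, a = x ^+ 2) (a \in squares).
Proof. by apply: (iffP imsetP) => -[x]; exists x. Qed.

Lemma squaresX x : x ^+ 2 \in squares.
Proof. by apply/squaresP; exists x. Qed.

Lemma squaresM a b : a \in squares -> b \in squares -> a * b \in squares.
Proof. by move=> /squaresP[x ->] /squaresP[y ->]; rewrite -exprMn squaresX. Qed.

Lemma squaresV a : a \in squares -> a^-1 \in squares.
Proof. by move=> /squaresP[x ->]; rewrite -exprVn squaresX. Qed.

Lemma squaresMl a b : a \in unit_squares ->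
  (a * b \in squares) = (b \in squares).
Proof.
rewrite !inE => /andP[aQ aU]; apply/idP/idP => [abQ|]; last exact: squaresM.
by rewrite -(mulKr aU b) squaresM ?squaresV.
Qed.

Lemma in_residue_class a x :
  (x \in residue_class a) = (x - a \isn't a GRing.unit).
Proof.
apply/imsetP/idP => [[z zM ->]|xaM].
  by move: zM; rewrite !inE addrC addKr.
by exists (x - a); rewrite ?inE // addrC subrK.
Qed.

Lemma residue_class_sym a x : (x \in residue_class a) = (a \in residue_class x).
Proof. by rewrite !in_residue_class -unitrN opprB. Qed.

Lemma card_residue_class a : #|residue_class a| = #|~: units|.
Proof. by rewrite card_imset //; exact: addrI. Qed.

Lemma hyperbola_diffs a :
  [set u.1 - u.2 | u in hyperbola a] = hyperbola_sums (- a).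
Proof.
apply/setP=> s; apply/imsetP/imsetP => -[[x y]]; rewrite inE /= => /eqP xyE ->.
  by exists (x, - y); rewrite ?inE /= ?mulrN ?xyE.
by exists (x, - y); rewrite ?inE /= ?mulrN ?xyE opprK.
Qed.

Lemma card_regular_hyperbola a : a \is a GRing.unit ->
  #|regular_hyperbola a| = #|[set x in units | x ^+ 2 - a \is a GRing.unit]|.
Proof.
move=> aU; have sqrB x y : x \is a GRing.unit -> x * y = a ->
    (x ^+ 2 - a \is a GRing.unit) = (x - y \is a GRing.unit).
  by move=> xU <-; rewrite expr2 -mulrBr unitrMr.
have -> : regular_hyperbola a
    = [set (x, a / x) | x in [set x in units | x ^+ 2 - a \is a GRing.unit]].
  apply/setP=> -[x y]; apply/idP/imsetP; last first.
    move=> [z]; rewrite !inE => /andP[zU rz] [-> ->].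
    have zE : z * (a / z) = a by rewrite mulrC divrK.
    by rewrite zE eqxx -(sqrB z).
  rewrite !inE /= => /andP[/eqP xyE xyU].
  have /andP[xU _] : (x \is a GRing.unit) && (y \is a GRing.unit).
    by rewrite -unitrM xyE.
  exists x; first by rewrite !inE xU (sqrB x y).
  by rewrite -xyE mulrC mulKr.
by rewrite card_imset // => x y [].
Qed.

Lemma regular_hyperbola_sums a :
  [set u.1 + u.2 | u in regular_hyperbola a] = regular_sums a.
Proof.
have discrE x y : (x + y) ^+ 2 - 4 * (x * y) = (x - y) ^+ 2 by ring.
apply/setP=> s; rewrite !inE; apply/imsetP/andP => [[[x y]]|[/imsetP[[x y]]]].
  rewrite !inE /= => /andP[xyE xyU] ->; split.
    by apply/imsetP; exists (x, y); rewrite ?inE.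
  by rewrite -(eqP xyE) discrE unitrX.
rewrite inE /= => /eqP xyE ->.
rewrite -xyE discrE unitrX_pos // => xyU.
by exists (x, y); rewrite ?inE //= xyE eqxx.
Qed.

Lemma card_regular_singular_sums a :
  (#|regular_sums a| + #|singular_sums a| = #|hyperbola_sums a|)%N.
Proof.
pose D := [set s : R | s ^+ 2 - 4 * a \is a GRing.unit].
rewrite -(cardsID D (hyperbola_sums a)) /regular_sums setIdE; congr addn.
by apply: eq_card => s; rewrite !inE andbC.
Qed.

Section TwoInvertible.

Hypothesis unit2 : (2 : R) \is a GRing.unit.

Lemma unit4 : (4 : R) \is a GRing.unit.
Proof. by rewrite (natrM R 2 2) unitrM unit2. Qed.

Lemma unit_square4 : 4 \in unit_squares.
Proof. by rewrite !inE unit4 andbT (natrX R 2 2) squaresX. Qed.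

Lemma oppr_unit_neq x : x \is a GRing.unit -> - x != x.
Proof.
move=> xU; have: 2 * x \is a GRing.unit by rewrite unitrM unit2.
by apply: contraTneq => xNx; rewrite mulr_natl mulr2n -{1}xNx addNr unitr0.
Qed.

Lemma mem_hyperbola_sums a s :
  (s \in hyperbola_sums a) = (s ^+ 2 - 4 * a \in squares).
Proof.
apply/imsetP/squaresP => [[[x y]]|[d dE]].
  by rewrite inE /= => /eqP <- ->; exists (x - y); ring.
exists ((s + d) / 2, (s - d) / 2); last first.
  by rewrite /= -mulrDl (_ : _ + _ = s * 2) ?mulrK //; ring.
rewrite inE /= mulrACA -invrM // -natrM mulrC [_ * (s - d)]mulrC -subr_sqr.
by rewrite -dE opprB addrCA subrr addr0 mulKr ?unit4.
Qed.

End TwoInvertible.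

End FiniteRing.

Definition local_ring (R : unitRingType) : Prop :=
  forall x y : R, x + y \is a GRing.unit ->
  (x \is a GRing.unit) || (y \is a GRing.unit).

Section LocalRing.

Variable R : comUnitRingType.
Hypothesis localR : local_ring R.
Implicit Types x y z : R.

Lemma local_mulf_eq0 x y : x + y \is a GRing.unit ->
  (x * y == 0) = (x == 0) || (y == 0).
Proof.
move=> /localR/orP[xU|yU].
- rewrite mulrI_eq0; last exact: mulrI.
  by case: (x =P 0) xU => // ->; rewrite unitr0.
- rewrite mulIr_eq0; last exact: mulIr.
  by case: (y =P 0) yU => [->|_]; rewrite ?unitr0 // orbF.
Qed.

Lemma local_unitDr z x : z \isn't a GRing.unit ->
  (x + z \is a GRing.unit) = (x \is a GRing.unit).
Proof.
move=> zM; apply/idP/idP => [|xU].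
  by case/localR/orP => //; apply/contraLR.
by have /localR/orP[//|] : x + z - z \is a GRing.unit;
  rewrite ?addrK // unitrN (negPf zM).
Qed.

End LocalRing.

Section OddLocalRing.

Variable R : finComUnitRingType.
Hypothesis localR : local_ring R.
Hypothesis unit2 : (2 : R) \is a GRing.unit.
Implicit Types a b x y z : R.

Lemma residue_class_unit a x : x \in residue_class a ->
  (x \is a GRing.unit) = (a \is a GRing.unit).
Proof.
by case/imsetP=> z zM ->; rewrite local_unitDr //; move: zM; rewrite !inE.
Qed.

Lemma sqr_eq_unit x y : x \is a GRing.unit ->
  (x ^+ 2 == y ^+ 2) = (y == x) || (y == - x).
Proof.
move=> xU; rewrite -subr_eq0 subr_sqr local_mulf_eq0 //.
  by rewrite subr_eq0 [x + y]addrC addr_eq0 [x == y]eq_sym.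
by rewrite (_ : _ + _ = 2 * x) ?unitrM ?unit2 //; ring.
Qed.

Lemma sqr_residue_class_inj c : c \is a GRing.unit ->
  {in residue_class c &, injective (fun x => x ^+ 2)}.
Proof.
move=> cU x y; rewrite !in_residue_class => xcM ycM.
have xyU : x + y \is a GRing.unit.
  have -> : x + y = 2 * c + (x - c) + (y - c) by ring.
  rewrite (local_unitDr localR _ ycM) (local_unitDr localR _ xcM).
  by rewrite unitrM unit2.
move/eqP; rewrite -subr_eq0 subr_sqr mulIr_eq0; last exact: mulIr.
by rewrite subr_eq0 => /eqP.
Qed.

(* Hensel's lemma for squares: squaring maps [c + M] injectively into
   [c ^+ 2 + M], and both residue classes have the cardinality of [M]. *)
Lemma residue_class_unit_squares a : a \in unit_squares R ->
  residue_class a \subset unit_squares R.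
Proof.
case/setIP=> /squaresP[c ->]; rewrite inE unitrX_pos // => cU.
have sqrE : [set x ^+ 2 | x in residue_class c] = residue_class (c ^+ 2).
  apply/eqP; rewrite eqEcard (card_in_imset (sqr_residue_class_inj cU)).
  rewrite !card_residue_class leqnn andbT; apply/subsetP=> _ /imsetP[x xcM ->].
  by move: xcM; rewrite !in_residue_class subr_sqr unitrM => /negPf->.
rewrite -sqrE; apply/subsetP=> _ /imsetP[x xcM ->].
by rewrite !inE squaresX unitrX ?(residue_class_unit xcM).
Qed.

Lemma card_sqr_preimset (A : {set R}) : A \subset unit_squares R ->
  #|[set x | x ^+ 2 \in A]| = (#|A| * 2)%N.
Proof.
move/subsetP=> sAQ; have sqrU x : x ^+ 2 \in A -> x \is a GRing.unit.
  by move/sAQ; rewrite !inE unitrX_pos // => /andP[].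
have {2}-> : A = [set x ^+ 2 | x in [set x | x ^+ 2 \in A]].
  apply/setP=> a; apply/idP/imsetP => [aA|[x]]; last by rewrite inE => ? ->.
  by have /setIP[/squaresP[x xE] _] := sAQ _ aA; exists x; rewrite // inE -xE.
apply: (card_two_to_one (s := -%R)) => [x|x|x y]; rewrite !inE ?sqrrN //.
- by move/sqrU; exact: oppr_unit_neq.
- by move/sqrU => xU _; exact: sqr_eq_unit.
Qed.

Lemma card_units_squares : #|units R| = (#|unit_squares R| * 2)%N.
Proof.
rewrite -card_sqr_preimset //; apply: eq_card => x.
by rewrite !inE squaresX unitrX_pos.
Qed.

Lemma mem_squaresM a b : a \is a GRing.unit -> b \is a GRing.unit ->
  (a * b \in squares R) = ((a \in squares R) == (b \in squares R)).
Proof.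
move=> aU bU; have [aQ|aNQ] := boolP (a \in squares R).
  by rewrite squaresMl // inE aQ inE.
have [bQ|bNQ] := boolP (b \in squares R).
  by rewrite mulrC squaresMl ?(negPf aNQ) // inE bQ inE.
have nonsquaresE : [set a * q | q in unit_squares R] = units R :\: squares R.
  apply/eqP; rewrite eqEcard; apply/andP; split.
    apply/subsetP=> _ /imsetP[q qQ ->]; rewrite !inE mulrC squaresMl // aNQ.
    by move: qQ; rewrite !inE unitrM aU andbT => /andP[].
  rewrite card_imset; last exact: mulrI.
  have := cardsID (squares R) (units R).
  by rewrite card_units_squares setIC muln2 -addnn => /addnI ->.
have: b \in units R :\: squares R by rewrite !inE bNQ.
rewrite -nonsquaresE => /imsetP[q /setIP[qQ _] ->].
by rewrite mulrA squaresM ?squaresX.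
Qed.

(* The fixed points of inversion on the unit squares are [1] and, when it is a
   square, [-1]; their number has the parity of the number of unit squares. *)
Lemma squaresN1 : (-1 \in squares R) = ~~ odd #|unit_squares R|.
Proof.
have Q1 : 1 \in squares R by rewrite -(expr1n R 2) squaresX.
have fixE : [set x in unit_squares R | x^-1 == x]
    = squares R :&: [set 1; -1].
  apply/setP=> x; rewrite !inE -andbA; congr andb.
  rewrite -sqr_eq_unit ?unitr1 // expr1n [RHS]eq_sym.
  apply/andP/idP => [[xU /eqP xVE]|/eqP x2].
    by rewrite expr2 -{1}xVE mulVr.
  have xU : x \is a GRing.unit by rewrite -(unitrX_pos x (n := 2)) // x2 unitr1.
  by split; rewrite // -(inj_eq (mulrI xU)) mulrV // -x2.
rewrite (@odd_card_involution _ GRing.inv) => [|x|x _]; last exact: invrK.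
  rewrite fixE; have [NQ|NNQ] := boolP (-1 \in squares R).
    rewrite (setIidPr _) ?subUset ?sub1set ?Q1 //.
    by rewrite cards2 eq_sym oppr_unit_neq ?unitr1.
  rewrite (_ : _ :&: _ = [set 1]) ?cards1 //; apply/setP=> x; rewrite !inE.
  have [->|_] := x =P 1; first by rewrite Q1.
  by have [->|_] := x =P -1; rewrite ?(negPf NNQ) ?andbF.
by rewrite !inE unitrV => /andP[xQ ->]; rewrite squaresV.
Qed.

Lemma card_regular_hyperbola_sums a :
  #|regular_hyperbola a| = (#|regular_sums a| * 2)%N.
Proof.
rewrite -regular_hyperbola_sums.
apply: (card_two_to_one (s := fun u => (u.2, u.1))).
- by move=> [x y]; rewrite !inE /= mulrC -unitrN opprB.
- move=> [x y]; rewrite !inE xpair_eqE /= => /andP[_]; apply: contraL.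
  by case/andP=> /eqP -> _; rewrite subrr unitr0.
move=> [x y] [z w]; rewrite !inE !xpair_eqE /=.
move=> /andP[/eqP xyE xyU] /andP[/eqP zwE _].
apply/eqP/orP => [sE|[] /andP[/eqP -> /eqP -> //]]; last exact: addrC.
have wE : w = x + y - z by rewrite sE addrC addKr.
suff: (z == x) || (z == y).
  by case/orP=> /eqP zE; [left|right];
    rewrite wE zE eqxx; apply/eqP; [rewrite addrC addKr|rewrite addrK].
rewrite [z == y]eq_sym -(subr_eq0 z x) -(subr_eq0 y z) -local_mulf_eq0 //.
  have -> : (z - x) * (y - z) = z * w - x * y by rewrite wE; ring.
  by rewrite zwE xyE subrr.
by rewrite addrC subrKA -unitrN opprB.
Qed.

Lemma card_hyperbola_sums a : a \is a GRing.unit ->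
  (#|hyperbola_sums a| * 2 + #|[set x | (x ^+ 2)%R \in residue_class a]|
   = #|units R| + #|singular_sums a| * 2)%N.
Proof.
move=> aU; have := card_regular_hyperbola aU.
rewrite card_regular_hyperbola_sums -card_regular_singular_sums.
rewrite -(cardsID [set x | x ^+ 2 - a \is a GRing.unit] (units R)) -setIdE.
have -> : units R :\: [set x | x ^+ 2 - a \is a GRing.unit]
    = [set x | x ^+ 2 \in residue_class a].
  apply/setP=> x; rewrite !inE in_residue_class; apply: andb_idr => xaM.
  by rewrite -(unitrX_pos x (n := 2)) // (residue_class_unit (a := a))
    ?in_residue_class.
by rewrite mulnDl => ->; rewrite addnAC.
Qed.

Lemma card_singular_sums a : a \in unit_squares R ->
  #|singular_sums a| = (#|nonunit_squares R| * 2)%N.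
Proof.
move=> aQ; pose A := [set 4 * a + z | z in nonunit_squares R].
have sAQ : A \subset unit_squares R.
  apply: subset_trans (residue_class_unit_squares (a := 4 * a) _).
    apply/subsetP=> _ /imsetP[z zNQ ->]; rewrite in_residue_class addrC addKr.
    by move: zNQ; rewrite !inE => /andP[].
  by move: aQ; rewrite !inE squaresMl ?unit_square4 // unitrM unit4.
have <- : #|A| = #|nonunit_squares R| by rewrite card_imset //; exact: addrI.
rewrite -card_sqr_preimset //; apply: eq_card => s; rewrite !inE.
rewrite mem_hyperbola_sums //; apply/andP/imsetP => [[dQ dM]|[z zNQ ->]].
  by exists (s ^+ 2 - 4 * a); [rewrite !inE dM|rewrite addrC subrK].
by apply/andP; move: zNQ; rewrite addrC addKr andbC !inE.
Qed.

Lemma card_hyperbola_sums_square a : a \in unit_squares R ->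
  (#|hyperbola_sums a| * 2 + #|~: units R| * 2
   = #|units R| + #|nonunit_squares R| * 4)%N.
Proof.
move=> aQ; have /setIP[_] := aQ; rewrite inE => aU.
have := card_hyperbola_sums aU; rewrite card_singular_sums //.
rewrite card_sqr_preimset; last exact: residue_class_unit_squares.
by rewrite card_residue_class -mulnA.
Qed.

Lemma sqr_notin_residue_class a x : a \is a GRing.unit -> a \notin squares R ->
  x ^+ 2 \notin residue_class a.
Proof.
move=> aU; apply: contra => xa.
have x2Q : x ^+ 2 \in unit_squares R.
  by rewrite !inE squaresX (residue_class_unit xa).
have /subsetP/(_ a) := residue_class_unit_squares x2Q.
by rewrite residue_class_sym => /(_ xa)/setIP[].
Qed.

Lemma card_hyperbola_sums_nonsquare a : a \is a GRing.unit ->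
  a \notin squares R -> (#|hyperbola_sums a| * 2 = #|units R|)%N.
Proof.
move=> aU aNQ; have := card_hyperbola_sums aU.
have -> : [set x | x ^+ 2 \in residue_class a] = set0.
  by apply/setP=> x; rewrite !inE (negPf (sqr_notin_residue_class x aU aNQ)).
have -> : singular_sums a = set0; last by rewrite !cards0 !addn0.
apply/setP=> s; rewrite !inE; case: (_ \in _) => //=.
rewrite -in_residue_class (negPf (sqr_notin_residue_class s _ _)) //.
  by rewrite unitrM unit4.
by rewrite squaresMl ?unit_square4.
Qed.

End OddLocalRing.

Section ResidueRing.

Variable n : nat.
Hypothesis n_gt1 : (1 < n)%N.

Lemma eqr_nat_Zp k m : (k%:R == m%:R :> 'Z_n) = (k == m %[mod n])%N.
Proof. by rewrite -val_eqE /= !val_Zp_nat. Qed.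

Lemma intr_Zp_eq0 (k : int) : (k%:~R == 0 :> 'Z_n) = (n%:Z %| k)%Z.
Proof.
have natr_eq0 m : ((m%:R : 'Z_n) == 0) = (n %| m)%N.
  by rewrite (eqr_nat_Zp m 0) mod0n.
rewrite dvdzE absz_nat.
by case: k => m; rewrite ?NegzE ?rmorphN ?oppr_eq0 ?abszN /= -?pmulrn natr_eq0.
Qed.

Lemma eqr_int_Zp (k m : int) :
  (k%:~R == m%:~R :> 'Z_n) = (k == m %[mod n%:Z])%Z.
Proof. by rewrite eqz_mod_dvd -subr_eq0 -rmorphB intr_Zp_eq0. Qed.

Lemma card_units_Zp_totient : #|units 'Z_n| = totient n.
Proof.
rewrite -card_units_Zp ?(ltnW n_gt1) // cardsT card_sub.
by apply: eq_card => x; rewrite !inE.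
Qed.

End ResidueRing.

Lemma H2_hyperbola m (a : int) : ~~ (m.+2%:Z %| a)%Z ->
  H2 a m.+2 = hyperbola (a%:~R : 'Z_m.+2).
Proof.
move=> nNa; apply/setP=> -[x y]; rewrite !inE /=.
have -> : (x * y == a%:~R :> 'Z_m.+2) = ((x * y)%N%:Z == a %[mod m.+2%:Z])%Z.
  by rewrite -eqr_int_Zp // -pmulrn natrM !natr_Zp.
rewrite andbA; apply: andb_idl => xyE; rewrite !lt0n -negb_or -muln_eq0.
apply: contra nNa => /eqP xy0; move: xyE.
by rewrite xy0 eq_sym eqz_mod_dvd subr0.
Qed.

Section ModularHyperbola.

Variables (n : nat) (a : int).
Hypotheses (n_gt1 : (1 < n)%N) (nNa : ~~ (n%:Z %| a)%Z).

Lemma S2bar_hyperbola_sums : S2bar a n = hyperbola_sums (a%:~R : 'Z_n).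
Proof.
case: n n_gt1 nNa => [|[|m]] // _ mNa; rewrite /S2bar H2_hyperbola //.
by apply: eq_imset => -[x y]; rewrite /= !natr_Zp.
Qed.

Lemma D2bar_hyperbola_sums : D2bar a n = hyperbola_sums (- a%:~R : 'Z_n).
Proof.
case: n n_gt1 nNa => [|[|m]] // _ mNa; 
  rewrite -hyperbola_diffs /D2bar H2_hyperbola //.
by apply: eq_imset => -[x y]; rewrite /= !natr_Zp.
Qed.

End ModularHyperbola.

Section PrimePower.

Variables (p : nat) (p_prime : prime p).

Lemma pexp_gt1 t : (1 < p ^ t.+1)%N.
Proof. by rewrite -(exp1n t.+1) ltn_exp2r // prime_gt1. Qed.

Lemma dvdz_pexpS t : (p%:Z %| (p ^ t.+1)%N%:Z)%Z.
Proof. by rewrite dvdzE !absz_nat expnS dvdn_mulr. Qed.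

Lemma natr_Zp_pexp_unit t m :
  ((m%:R : 'Z_(p ^ t.+1)) \is a GRing.unit) = ~~ (p %| m)%N.
Proof. by rewrite unitZpE ?pexp_gt1 // coprime_pexpl // prime_coprime. Qed.

Lemma intr_Zp_pexp_unit t (a : int) :
  ((a%:~R : 'Z_(p ^ t.+1)) \is a GRing.unit) = ~~ (p%:Z %| a)%Z.
Proof.
rewrite dvdzE absz_nat -(natr_Zp_pexp_unit t).
by case: a => m; rewrite ?NegzE ?rmorphN ?unitrN ?abszN /= -?pmulrn.
Qed.

Lemma Zp_pexp_local t : local_ring 'Z_(p ^ t.+1).
Proof.
move=> x y; rewrite -(natr_Zp x) -(natr_Zp y) -natrD.
rewrite !natr_Zp_pexp_unit -negb_and.
by apply: contra => /andP[]; exact: dvdn_add.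
Qed.

Lemma card_units_Zp_pexp t : #|units 'Z_(p ^ t.+1)| = (p.-1 * p ^ t)%N.
Proof. by rewrite card_units_Zp_totient ?pexp_gt1 // totient_pfactor. Qed.

Lemma card_nonunits_Zp_pexp t : #|~: units 'Z_(p ^ t.+1)| = (p ^ t)%N.
Proof.
apply: (@addnI #|units 'Z_(p ^ t.+1)|); rewrite cardsC card_units_Zp_pexp.
rewrite card_ord Zp_cast ?pexp_gt1 // expnS -{1}(prednK (prime_gt0 p_prime)).
by rewrite mulSn addnC.
Qed.

Lemma nonunit_squares_Zp_pexpP t (s : 'Z_(p ^ t.+1)) :
  reflect (exists k, s = (p ^ 2 * k ^ 2)%N%:R) (s \in nonunit_squares _).
Proof.
apply: (iffP setDP) => [[/squaresP[x ->]]|[k ->]].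
  rewrite inE unitrX_pos // -(natr_Zp x) natr_Zp_pexp_unit negbK.
  by case/dvdnP=> k ->; exists k; rewrite -natrX mulnC expnMn.
rewrite -expnMn inE natr_Zp_pexp_unit natrX squaresX.
by rewrite Euclid_dvdX // dvdn_mulr.
Qed.

Lemma nonunit_squares_Zp_pexp_small t : (t <= 1)%N ->
  nonunit_squares 'Z_(p ^ t.+1) = [set 0].
Proof.
move=> t_le1; apply/setP=> s; rewrite [RHS]inE.
apply/nonunit_squares_Zp_pexpP/eqP => [[k ->]|->].
  apply/eqP; rewrite (eqr_nat_Zp (pexp_gt1 t) _ 0) mod0n -/(dvdn _ _).
  by rewrite dvdn_mulr // dvdn_exp2l.
by exists 0%N; rewrite muln0.
Qed.

(* Multiplication by [p ^ 2] embeds [Z/p^t] into [Z/p^(t+2)], and [x ^+ 2] is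
   mapped to the nonunit square [(p * x) ^+ 2]. *)
Lemma card_nonunit_squares_Zp_pexpSS t :
  #|nonunit_squares 'Z_(p ^ t.+3)| = #|squares 'Z_(p ^ t.+1)|.
Proof.
have [n1 n3] := (pexp_gt1 t, pexp_gt1 t.+2).
have nE : (p ^ t.+3 = p ^ 2 * p ^ t.+1)%N by rewrite -expnD.
pose mulp2 (x : 'Z_(p ^ t.+1)) : 'Z_(p ^ t.+3) := (p ^ 2 * x)%N%:R.
have mulp2_nat k : mulp2 k%:R = (p ^ 2 * k)%N%:R.
  by apply/eqP; rewrite eqr_nat_Zp // val_Zp_nat // nE -!muln_modr modn_mod.
have mulp2_inj : injective mulp2.
  move=> x y /eqP; rewrite eqr_nat_Zp // nE -!muln_modr eqn_pmul2l.
    by rewrite -eqr_nat_Zp // !natr_Zp => /eqP.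
  by rewrite expn_gt0 prime_gt0.
rewrite -(card_imset _ mulp2_inj); apply: eq_card => s.
apply/nonunit_squares_Zp_pexpP/imsetP => [[k ->]|[_ /squaresP[x ->] ->]].
  by exists (k%:R ^+ 2); rewrite ?squaresX // -natrX mulp2_nat.
by exists x; rewrite -{1}(natr_Zp x) -natrX mulp2_nat.
Qed.

Hypothesis p_odd : odd p.

Lemma Zp_pexp_unit2 t : (2 : 'Z_(p ^ t.+1)) \is a GRing.unit.
Proof. by rewrite natr_Zp_pexp_unit gtnNdvd ?odd_prime_gt2. Qed.

Lemma card_unit_squares_Zp_pexp t :
  #|unit_squares 'Z_(p ^ t.+1)| = (p./2 * p ^ t)%N.
Proof.
have := card_units_squares (@Zp_pexp_local t) (Zp_pexp_unit2 t).
rewrite card_units_Zp_pexp -odd_halfK // -muln2 mulnAC => /eqP.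
by rewrite eqn_pmul2r // => /eqP.
Qed.

Lemma card_nonunit_squares_Zp_pexp t :
  #|nonunit_squares 'Z_(p ^ t.+1)|%:R * 2 =
    p%:R ^+ t / (p%:R + 1) + 3 / 2
    + (-1) ^+ t * (p%:R - 1) / (2 * (p%:R + 1)) :> rat.
Proof.
have p1_neq0 : (p%:R + 1 : rat) != 0 by rewrite natr1 pnatr_eq0.
have pE : p%:R - 1 = p./2%:R * 2 :> rat.
  by rewrite -natrM muln2 odd_halfK // -subn1 natrB ?prime_gt0.
elim/ltn_ind: t => -[|[|t]] IHt.
- by rewrite nonunit_squares_Zp_pexp_small // cards1; field.
- by rewrite nonunit_squares_Zp_pexp_small // cards1; field.
rewrite card_nonunit_squares_Zp_pexpSS -(cardsID (units _)).
rewrite card_unit_squares_Zp_pexp natrD mulrDl IHt //.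
by rewrite natrM natrX mulrAC -pE !exprS; field.
Qed.

Lemma mem_squaresN_Zp_pexp t (a : 'Z_(p ^ t.+1)) : a \is a GRing.unit ->
  (- a \in squares _) = ((p %% 4 == 1)%N == (a \in squares _)).
Proof.
move=> aU; have locZ := @Zp_pexp_local t; have unit2 := Zp_pexp_unit2 t.
rewrite -mulN1r mem_squaresM ?unitrN ?unitr1 // squaresN1 //.
rewrite card_unit_squares_Zp_pexp oddM oddX p_odd orbT andbT.
by congr (_ == _); move: (p) p_odd; lia.
Qed.

Lemma legendre_squares t (a : int) : ~~ (p%:Z %| a)%Z ->
  legendre a p = if a%:~R \in squares 'Z_(p ^ t.+1) then 1 else -1.
Proof.
move=> pNa; rewrite /legendre (negPf pNa); congr (if _ then _ else _).
have locZ := @Zp_pexp_local t.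
have := pNa; rewrite -(intr_Zp_pexp_unit t) => aU.
apply/existsP/idP => [[x]|/squaresP[z zE]].
  rewrite eqz_mod_dvd => xE; apply: contraLR (xE) => aNQ.
  have := sqr_notin_residue_class locZ (Zp_pexp_unit2 t) x%:R aU aNQ.
  by rewrite in_residue_class negbK -natrX pmulrn -rmorphB intr_Zp_pexp_unit.
exists (Ordinal (ltn_pmod z (prime_gt0 p_prime))) => /=.
rewrite modz_nat modnXm -modz_nat.
have : ((z ^ 2)%N%:Z == a %[mod (p ^ t.+1)%N%:Z])%Z.
  by rewrite -eqr_int_Zp ?pexp_gt1 // -pmulrn natrX natr_Zp zE.
by rewrite !eqz_mod_dvd; apply: dvdz_trans; exact: dvdz_pexpS.
Qed.

Lemma card_hyperbola_sums_Zp_pexp t (a : 'Z_(p ^ t.+1)) :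
  a \is a GRing.unit ->
  #|hyperbola_sums a|%:R = if a \in squares _ then A_count p t.+1
                           else (totient (p ^ t.+1))%:R / 2 :> rat.
Proof.
move=> aU; have locZ := @Zp_pexp_local t; have unit2 := Zp_pexp_unit2 t.
have [aQ|aNQ] := ifPn; last first.
  rewrite -card_units_Zp_totient ?pexp_gt1 //.
  by rewrite -(card_hyperbola_sums_nonsquare locZ unit2 aU aNQ) natrM mulfK.
have aUQ : a \in unit_squares _ by rewrite inE aQ inE.
have -> : A_count p t.+1
    = (p%:R - 3) * p%:R ^+ t / 2 + #|nonunit_squares 'Z_(p ^ t.+1)|%:R * 2.
  by rewrite card_nonunit_squares_Zp_pexp /A_count /= !addrA.
have := card_hyperbola_sums_square locZ unit2 aUQ.
move/(congr1 (fun m => m%:R : rat)).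
rewrite card_nonunits_Zp_pexp card_units_Zp_pexp -subn1 !natrD !natrM natrX.
by rewrite natrB ?prime_gt0 //; lra.
Qed.

End PrimePower.

Theorem theorem3p6 (p t : nat) (a : int)
    (p_gt2 : (2 < p)%N) (p_prime : prime p) (t_ge1 : (1 <= t)%N)
    (pNa : ~~ (p%:Z %| a)%Z) :
  [/\ legendre a p = 1 ->
        #|S2bar a (p ^ t)|%:R = A_count p t :> rat,
      legendre a p = -1 ->
        #|S2bar a (p ^ t)|%:R = (totient (p ^ t))%:R / 2%:R :> rat,
      (p = 1 %[mod 4])%N /\ legendre a p = 1 \/
      (p = 3 %[mod 4])%N /\ legendre a p = -1 ->
        #|D2bar a (p ^ t)|%:R = A_count p t :> rat
    & (p = 1 %[mod 4])%N /\ legendre a p = -1 \/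
      (p = 3 %[mod 4])%N /\ legendre a p = 1 ->
        #|D2bar a (p ^ t)|%:R = (totient (p ^ t))%:R / 2%:R :> rat].
Proof.
case: t t_ge1 => // t _.
have p_odd : odd p by case: (even_prime p_prime) p_gt2 => // ->.
have pexpNa : ~~ ((p ^ t.+1)%N%:Z %| a)%Z.
  by apply: contra pNa; apply: dvdz_trans; exact: dvdz_pexpS.
have aU : (a%:~R : 'Z_(p ^ t.+1)) \is a GRing.unit by rewrite intr_Zp_pexp_unit.
rewrite S2bar_hyperbola_sums ?D2bar_hyperbola_sums ?pexp_gt1 //.
rewrite !card_hyperbola_sums_Zp_pexp ?unitrN //.
rewrite (legendre_squares p_prime p_odd t pNa).
rewrite (mem_squaresN_Zp_pexp p_prime) //.
by case: (_ \in _); split=> // -[] [p_mod4 //]; rewrite p_mod4.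
Qed.
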